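(* Let $\Lambda$ be a class of stationary memoryless sources on the alphabet $\mathbb{N}_+$. For $k\in\mathbb{N}_+$ let $\hat p(k)=\sup_{P\in\Lambda}P^1\{k\}$, and let the tail function be $\bar F_{\Lambda^1}(u)=\sum_{k>u}\hat p(k)$. Then for every positive integer $n$, $$R^*(\Lambda^n)\le \inf_{u:\ u\le n}\left[n\,\bar F_{\Lambda^1}(u)\log e+\frac{u-1}{2}\log n\right]+2,$$ where the infimum is over positive integers $u\le n$.
   Context: Logarithms are in base 2; $e$ is the base of natural logarithms; $\mathbb{N}_+=\{1,2,\dots\}$. A source on a countable alphabet $\mathcal{X}$ is a probability distribution $P$ on $\mathcal{X}^{\mathbb{N}}$; $P^n$ is the law of the first $n$ symbols and $\Lambda^n=\{P^n:P\in\Lambda\}$. A stationary memoryless source is one whose symbols are i.i.d. Throughout, only sources with finite Shannon entropy $H(X_{1:n})$ are considered. $\mathfrak{M}_1(\mathcal{X}^n)$ is the set of probability distributions on $\mathcal{X}^n$. Minimax regret: $R^*(\Lambda^n)=\inf_{Q^n\in\mathfrak{M}_1(\mathcal{X}^n)}\sup_{\mathbf{x}\in\mathcal{X}^n}\sup_{P\in\Lambda}\log\frac{P^n(\mathbf{x})}{Q^n(\mathbf{x})}$, with the conventions $0/0=0$, $\log0=-\infty$, $\log(a/0)=+\infty$ for $a>0$. *)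

(* Defs.v *)
From HB Require Import structures.
From mathcomp Require Import all_boot all_order all_algebra.
From mathcomp Require Import all_classical all_reals all_analysis.

Set Implicit Arguments.
Unset Strict Implicit.
Unset Printing Implicit Defensive.

Import Order.TTheory GRing.Theory Num.Theory.

Local Open Scope classical_set_scope.
Local Open Scope ring_scope.
Local Open Scope ereal_scope.

Definition Npos := {k : nat | (0 < k)%N}.

HB.instance Definition _ := Countable.on Npos.
HB.instance Definition _ := isPointed.Build Npos (exist _ 1%N isT).
HB.instance Definition _ := @isMeasurable.Build default_measure_display
  Npos discrete_measurable discrete_measurable0
  discrete_measurableC discrete_measurableU.

Section sources.
Context {d : measure_display} {X : measurableType d} {R : realType}.

Definition coord_cylinders : set (set (nat -> X)) :=
  [set B | exists i (A : set X), measurable A /\ B = [set w | A (w i)]].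

(* X^N with the product sigma-algebra; the symbols X_1, X_2, ... of the
   source are the coordinates w 0, w 1, ... *)
Definition sequence_space : Type := g_sigma_algebraType coord_cylinders.

HB.instance Definition _ := Measurable.on sequence_space.

Definition independent_symbols (P : probability sequence_space R) : Prop :=
  forall (I : seq nat) (A : nat -> set X), uniq I ->
    (forall i, measurable (A i)) ->
    P [set w | forall i, i \in I -> A i (w i)] =
    \prod_(i <- I) P [set w | A i (w i)].

Definition identically_distributed_symbols (P : probability sequence_space R) :
    Prop :=
  forall i j (A : set X), measurable A ->
    P [set w | A (w i)] = P [set w | A (w j)].

Definition stationary_memoryless (P : probability sequence_space R) : Prop :=
  independent_symbols P /\ identically_distributed_symbols P.

Definition first_symbols (n : nat) (w : sequence_space) : n.-tuple X :=
  [tuple w i | i < n].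

Lemma measurable_first_symbols n :
  measurable_fun [set: sequence_space] (@first_symbols n).
Proof.
apply/measurable_fun_tnthP => i _ A mA; rewrite setTI.
apply: sub_sigma_algebra; exists (i : nat), A; split => //.
by apply/seteqP; split => w /=; rewrite tnth_mktuple.
Qed.

HB.instance Definition _ n := isMeasurableFun.Build _ _ _ _
  (@first_symbols n) (@measurable_first_symbols n).

Definition law (n : nat) (P : probability sequence_space R) :
    probability (n.-tuple X) R :=
  distribution P (@first_symbols n).

Definition laws (n : nat) (L : set (probability sequence_space R)) :
    set (probability (n.-tuple X) R) :=
  [set law n P | P in L].

End sources.
Arguments sequence_space {d} X.
Arguments law {d X R} n P.
Arguments laws {d X R} n L.

(* Base-2 logarithm; lne 0 = -oo and lne +oo = +oo. *)
Definition elog2 {R : realType} (x : \bar R) : \bar R :=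
  lne x * ((ln 2)^-1)%:E.

(* Shannon entropy of a distribution on a countable set;
   0 * elog2 0 = 0 * -oo = 0. *)
Definition entropy {d : measure_display} {T : measurableType d} {R : realType}
    (Q : probability T R) : \bar R :=
  \esum_(x in [set: T]) - (Q [set x] * elog2 (Q [set x])).

Definition finite_entropy {d : measure_display} {X : measurableType d}
    {R : realType} (P : probability (sequence_space X) R) : Prop :=
  forall n : nat, entropy (law n P) < +oo.

(* In \bar R, 0 / 0 = 0 * +oo = 0 and a / 0 = +oo for a > 0. *)
Definition minimax_regret {d : measure_display} {T : measurableType d}
    {R : realType} (M : set (probability T R)) : \bar R :=
  ereal_inf [set ereal_sup [set ereal_sup
      [set elog2 (P [set x] / Q [set x]) | P in M]
    | x in [set: T]] | Q in [set: probability T R]].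

Section tail.
Context {R : realType}.
Implicit Type M : set (probability (1.-tuple Npos) R).

Definition envelope M (k : Npos) : \bar R :=
  ereal_sup [set Q [set [tuple k]] | Q in M].

Definition tail M (u : nat) : \bar R :=
  \esum_(k in [set k : Npos | (u < sval k)%N]) envelope M k.

End tail.

(* Main.v *)
Require Import Defs.
From mathcomp Require Import all_boot all_order all_algebra.
From mathcomp Require Import all_classical all_reals all_analysis.
From mathcomp Require Import ring lra.

(** The minimax regret of a class is at most log C as soon as one coding
    distribution Q satisfies P(x) <= C Q(x) for every source P and word x
    ([minimax_regret_le]).  Fix a threshold u, let F be the tail of the envelope
    beyond u, and let S = {1, ..., u}.  The coding distribution is explicit and
    sequential: having read a word with k letters in S, of which n_a are equal
    to a, it gives the next letter a weight
      (n_a + 1/2) / (k + u/2)   if a is in S   (Krichevsky-Trofimov rule),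
      hat p(a)                  otherwise,
    and divides by the total weight 1 + F.  Without the divisions by 1 + F, the
    weight of a word x has the closed form
      W(x) = prod_(x_i not in S) hat p(x_i)
             * prod_(a in S) (1/2)_(n_a) / (u/2)_k,
    where (y)_m = y (y + 1) ... (y + m - 1) ([mixture_weight]), and the words of
    length n have total weight (1 + F)^n ([esum_mixture_weight]).

    It remains to compare P(x) = prod p(x_i) with W(x).  Letters outside S are
    controlled by the envelope.  For those in S one needs
      prod_a p_a^(n_a) / (1/2)_(n_a) <= (sum_a p_a)^k / (1/2)_k,
    which follows by adding letters one at a time from its two-letter case
    ([rising_half_prod], [rising_half_pow2]).  The arithmetic-geometric mean
    inequality bounds p^a q^b by a^a b^b / (a + b)^(a + b) times
    (p + q)^(a + b), so the two-letter case reduces to supermultiplicativity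
    of m |-> m^m / (1/2)_m, that is, to monotonicity of its successive ratios
    ([selfpower_ratio_homo]); this is in turn a polynomial inequality once
    (1 - 1/m^2)^m is bounded below by its third-order Taylor polynomial
    ([ler_bernoulli3]).

    Hence P(x) <= (u/2)_n / (1/2)_n * W(x) ([le_mixture_weight]).  The factor
    (u/2)_n / (1/2)_n is 1 for u = 1, at most 2 sqrt n for u = 2, and is
    multiplied by 1 + 2n/u when u grows by 2, so that it is at most
    4 n^((u-1)/2) for u <= n ([rising_ratio_le]).  Altogether
    C = 4 n^((u-1)/2) (1 + F)^n, and ln (1 + F) <= F gives the theorem. *)

Import Order.TTheory GRing.Theory Num.Theory.

Set Implicit Arguments.
Unset Strict Implicit.
Unset Printing Implicit Defensive.

Local Open Scope classical_set_scope.
Local Open Scope ring_scope.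
Local Open Scope ereal_scope.

(** * Rising factorials and the function m^m / (1/2)_m *)

Section rising.
Local Open Scope ring_scope.

Definition rising {F : realFieldType} (x : F) (n : nat) : F :=
  \prod_(i < n) (x + i%:R).

Lemma risingS (F : realFieldType) (x : F) n :
  rising x n.+1 = rising x n * (x + n%:R).
Proof. by rewrite /rising big_ord_recr. Qed.

Lemma rising_gt0 (F : realFieldType) (x : F) n : 0 < x -> 0 < rising x n.
Proof. by move=> x0; apply: prodr_gt0 => i _; rewrite ltr_wpDr. Qed.

Lemma rising_shift (F : realFieldType) (x : F) n :
  x * rising (x + 1) n = rising x n * (x + n%:R).
Proof.
rewrite -risingS /rising big_ord_recl addr0; congr (_ * _).
by apply: eq_bigr => i _; rewrite /= /bump /= natrD addrA.
Qed.

(** By induction: multiplying the polynomial for [m] by [1 - t] leaves the one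
    for [m.+1] plus a nonnegative remainder in [t ^+ 4].  Bernoulli's
    inequality, which stops at the first order, is too weak for
    [selfpower_log_convex], where the two sides expanded in 1/m agree up to
    order 2. *)
Lemma ler_bernoulli3 (F : realFieldType) (t : F) (m : nat) : 0 <= t <= 1 ->
  1 - m%:R * t + m%:R * (m%:R - 1) / 2 * t ^+ 2
    - m%:R * (m%:R - 1) * (m%:R - 2) / 6 * t ^+ 3 <= (1 - t) ^+ m.
Proof.
move=> /andP[t0 t1]; elim: m => [|m IH]; first by rewrite expr0; lra.
have pos : 0 <= m%:R * (m%:R - 1) * (m%:R - 2) / 6 * t ^+ 4 :> F.
  apply: mulr_ge0; last exact: exprn_ge0.
  case: m {IH} => [|[|m]]; rewrite ?(subrr, mulr0, mul0r) //.
have t1' : 0 <= 1 - t by rewrite subr_ge0.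
rewrite [(1 - t) ^+ m.+1]exprS; apply: le_trans (ler_wpM2l t1' IH).
rewrite -natr1 -subr_ge0; apply: le_trans pos _; rewrite le_eqVlt; apply/orP; left.
by apply/eqP; field.
Qed.

(** The monotonicity of [selfpower_ratio], cleared of denominators.  With
    m = k + 1, the quotient k^m (k + 2)^m / m^(2m) is (1 - 1/m^2)^m. *)
Lemma selfpower_log_convex (F : realFieldType) (k : nat) :
  k.+1%:R ^+ (2 * k.+1) * (k%:R + 3 / 2)
    <= k%:R ^+ k * k.+2%:R ^+ k.+2 * (k%:R + 2^-1) :> F.
Proof.
case: k => [|k]; first by rewrite !expr0 expr1n; lra.
set x : F := k.+1%:R; have x1 : 1 <= x by rewrite ler1n.
have -> : k.+2%:R = x + 1 :> F by rewrite /x -natr1.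
have -> : k.+3%:R = x + 2 :> F by rewrite /x -!natr1; lra.
set m := x + 1; have m0 : 0 < m by rewrite /m; lra.
have t01 : 0 <= (m ^+ 2)^-1 <= 1.
  by rewrite invr_ge0 exprn_ge0 ?(ltW m0)//= invf_le1 ?exprn_gt0// exprn_ege1// /m; lra.
have := @ler_bernoulli3 F _ k.+2 t01; have -> : k.+2%:R = m by rewrite /m /x natr1.
have -> : 1 - (m ^+ 2)^-1 = x * (x + 2) / m ^+ 2 by rewrite /m; field; lra.
set p := (X in _ <= X) => B.
have pE : p * m ^+ (2 * k.+2) = x ^+ k.+2 * (x + 2) ^+ k.+2.
  by rewrite /p !exprMn exprVn -exprM mulfVK// expf_neq0// lt0r_neq0.
have poly : x * (2 * x + 3) <= p * ((x + 2) * (2 * x + 1)).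
  apply: le_trans (ler_wpM2r _ B); last by nra.
  rewrite -subr_ge0.
  have -> : (1 - m / m ^+ 2 + m * (m - 1) / 2 * (m ^+ 2)^-1 ^+ 2
     - m * (m - 1) * (m - 2) / 6 * (m ^+ 2)^-1 ^+ 3) * ((x + 2) * (2 * x + 1))
     - x * (2 * x + 3) = x * (m ^+ 3 + 3 * m - 2) / (6 * m ^+ 5).
    by rewrite /m; field; lra.
  apply: divr_ge0; last by rewrite mulr_ge0 ?exprn_ge0 ?(ltW m0).
  apply: mulr_ge0; first lra.
  by have := exprn_ge0 3 (ltW m0); rewrite /m; lra.
have := ler_wpM2r (exprn_ge0 (2 * k.+2) (ltW m0)) poly.
have -> : p * ((x + 2) * (2 * x + 1)) * m ^+ (2 * k.+2)
  = 2 * x * (x ^+ k.+1 * (x + 2) ^+ k.+3 * (x + 2^-1)).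
  by rewrite mulrAC pE [x ^+ k.+2]exprS [(x + 2) ^+ k.+3]exprS; field.
have -> : x * (2 * x + 3) * m ^+ (2 * k.+2) = 2 * x * (m ^+ (2 * k.+2) * (x + 3 / 2)).
  by field.
by rewrite ler_pM2l//; lra.
Qed.

Definition selfpower {F : realFieldType} (k : nat) : F :=
  k%:R ^+ k / rising 2^-1 k.

(** [selfpower k.+1 / selfpower k], see [selfpowerS]. *)
Definition selfpower_ratio {F : realFieldType} (k : nat) : F :=
  k.+1%:R ^+ k.+1 / (k%:R ^+ k * (k%:R + 2^-1)).

Lemma selfpower_ratio_ge0 (F : realFieldType) k : 0 <= selfpower_ratio k :> F.
Proof.
by rewrite divr_ge0 ?exprn_ge0 ?mulr_ge0 ?exprn_ge0// addr_ge0 ?invr_ge0.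
Qed.

Lemma selfpower_ratio_homo (F : realFieldType) :
  {homo @selfpower_ratio F : j k / (j <= k)%N >-> j <= k}.
Proof.
apply: homo_leq => [//|y x z|k]; first exact: le_trans.
have kk0 : 0 < k%:R ^+ k :> F by case: k => [|k]; rewrite ?expr0// exprn_gt0.
have k0 : 0 <= k%:R :> F by [].
rewrite ler_pdivrMr ?mulr_gt0//.
rewrite mulrAC ler_pdivlMr ?mulr_gt0 ?exprn_gt0//.
have := selfpower_log_convex F k; rewrite mul2n -addnn exprD -natr1; lra.
Qed.

Lemma selfpower_gt0 (F : realFieldType) k : 0 < selfpower k :> F.
Proof.
rewrite divr_gt0 ?rising_gt0 ?invr_gt0//.
by case: k => [|k]; rewrite ?expr0// exprn_gt0.
Qed.

Lemma selfpowerS (F : realFieldType) k :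
  selfpower k.+1 = selfpower_ratio k * selfpower k :> F.
Proof.
have kk0 : k%:R ^+ k != 0 :> F.
  by case: k => [|k]; rewrite ?expr0 ?oner_neq0// expf_neq0.
have r0 : rising (2^-1) k != 0 :> F by rewrite lt0r_neq0// rising_gt0 ?invr_gt0.
have k0 : 0 <= k%:R :> F by [].
by rewrite /selfpower_ratio /selfpower risingS; field; rewrite r0 kk0 /=; lra.
Qed.

(** Since the successive ratios increase, appending [j] steps after [k] steps
    gains more than starting them from zero. *)
Lemma selfpowerD (F : realFieldType) j k :
  selfpower j * selfpower k <= selfpower (j + k) :> F.
Proof.
elim: j => [|j IH].
  by rewrite /selfpower [rising _ 0]big_ord0 expr0 divr1 mul1r.
rewrite addSn 2!selfpowerS -mulrA.
apply: ler_pM => //; last exact/selfpower_ratio_homo/leq_addr.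
- exact: selfpower_ratio_ge0.
- by rewrite mulr_ge0// ltW// selfpower_gt0.
Qed.

(** The arithmetic-geometric mean inequality for [a] copies of [p / a] and [b]
    copies of [q / b]. *)
Lemma AGM_pow2 (F : realFieldType) (p q : F) a b : 0 <= p -> 0 <= q ->
  p ^+ a * q ^+ b * (a + b)%:R ^+ (a + b)
    <= a%:R ^+ a * b%:R ^+ b * (p + q) ^+ (a + b).
Proof.
move=> p0 q0.
(* The copies [p / a] and [q / b] need nonzero multiplicities. *)
case: a => [|a].
  rewrite !expr0 !mul1r add0n mulrC ler_wpM2l ?exprn_ge0//.
  by rewrite lerXn2r ?nnegrE ?addr_ge0// lerDr.
case: b => [|b].
  rewrite !expr0 !mulr1 addn0 mulrC ler_wpM2l ?exprn_ge0//.
  by rewrite lerXn2r ?nnegrE ?addr_ge0// lerDl.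
set A := a.+1; set B := b.+1.
pose E (i : 'I_A + 'I_B) : F := if i is inl _ then p / A%:R else q / B%:R.
have E0 : {in predT, forall i, 0 <= E i}.
  by move=> [i|i] _ /=; rewrite divr_ge0.
have A0 : A%:R != 0 :> F by rewrite pnatr_eq0.
have B0 : B%:R != 0 :> F by rewrite pnatr_eq0.
have AB0 : (A + B)%:R != 0 :> F by rewrite pnatr_eq0.
have [+ _] := leif_AGM E0.
rewrite !big_sumType /= !prodr_const !sumr_const card_sum !card_ord.
rewrite -(mulr_natr (p / _)) -(mulr_natr (q / _)) !divfK// !expr_div_n mulrACA -invfM.
rewrite ler_pdivrMr ?mulr_gt0 ?exprn_gt0 ?ltr0n//.
by rewrite mulrAC ler_pdivlMr ?exprn_gt0 ?ltr0n// [X in _ <= X]mulrC.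
Qed.

(** For p + q = 1 this says that a binary word of length n = a + b loses at most
    the factor [rising 1 n / rising 2^-1 n] when it is coded with the
    Krichevsky-Trofimov weights instead of the probabilities [p] and [q].
    [AGM_pow2] bounds the left-hand side for the worst [p] and [q], and
    [selfpowerD] compares that bound with the rising factorials. *)
Lemma rising_half_pow2 (F : realFieldType) (p q : F) a b : 0 <= p -> 0 <= q ->
  p ^+ a * q ^+ b * rising 2^-1 (a + b)
    <= rising 2^-1 a * rising 2^-1 b * (p + q) ^+ (a + b).
Proof.
move=> p0 q0.
have r0 k : 0 < rising 2^-1 k :> F by rewrite rising_gt0 ?invr_gt0.
have spE k : k%:R ^+ k = selfpower k * rising 2^-1 k :> F.
  by rewrite /selfpower divfK// lt0r_neq0.
have := AGM_pow2 a b p0 q0; rewrite !spE => H.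
rewrite -(ler_pM2l (selfpower_gt0 F (a + b))).
apply: (@le_trans _ _ (selfpower a * selfpower b *
    (rising 2^-1 a * rising 2^-1 b * (p + q) ^+ (a + b)))); first by lra.
by rewrite ler_wpM2r ?selfpowerD// !mulr_ge0 ?exprn_ge0 ?addr_ge0 ?(ltW (r0 _)).
Qed.

(** The letters of [S] are merged one by one: those already merged act as a
    single letter of probability the partial sum, so each step is an instance
    of [rising_half_pow2]. *)
Lemma rising_half_prod (F : realFieldType) (T : Type) (S : seq T) (p : T -> F)
    (c : T -> nat) : (forall b, 0 <= p b) ->
  (\prod_(b <- S) p b ^+ c b) * rising 2^-1 (\sum_(b <- S) c b)
    <= (\prod_(b <- S) rising 2^-1 (c b))
       * (\sum_(b <- S) p b) ^+ (\sum_(b <- S) c b).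
Proof.
move=> p0; have r0 k : 0 < rising 2^-1 k :> F by rewrite rising_gt0 ?invr_gt0.
elim: S => [|b S IH].
  by rewrite !big_nil expr0 mulr1 /rising big_ord0 mulr1.
rewrite !big_cons; set C := (\sum_(j <- S) c j)%N in IH *.
set s := \sum_(j <- S) p j in IH *.
set X := \prod_(j <- S) _ in IH *; set Y := \prod_(j <- S) _ in IH *.
have s0 : 0 <= s by exact: sumr_ge0.
have Y0 : 0 <= Y by apply: prodr_ge0 => j _; exact: ltW.
rewrite -(ler_pM2r (r0 C)).
apply: (@le_trans _ _ (p b ^+ c b * rising 2^-1 (c b + C) * (Y * s ^+ C))).
  rewrite [leLHS](_ : _ = p b ^+ c b * rising 2^-1 (c b + C) * (X * rising 2^-1 C));
    last by ring.
  by rewrite ler_wpM2l// mulr_ge0 ?exprn_ge0 ?(ltW (r0 _)).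
have := ler_wpM2l Y0 (rising_half_pow2 (c b) C (p0 b) s0); lra.
Qed.

Lemma rising_ratio_homo (F : realFieldType) (x y : F) : 0 < y -> y <= x ->
  {homo (fun k => rising x k / rising y k) : j k / (j <= k)%N >-> j <= k}.
Proof.
move=> y0 yx; apply: homo_leq => [//|? ? ?|k]; first exact: le_trans.
have x0 := lt_le_trans y0 yx; have k0 : 0 <= k%:R :> F by [].
rewrite !risingS invfM mulrACA ler_peMr//.
  by rewrite divr_ge0// ltW// rising_gt0.
by rewrite ler_pdivlMr ?mul1r ?lerD2r// ltr_wpDr.
Qed.

Lemma rising_ratio_add1 (F : realFieldType) (x y : F) n : 0 < x ->
  rising (x + 1) n / y = rising x n / y * ((x + n%:R) / x).
Proof.
move=> x0; have xn0 := lt0r_neq0 x0.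
have -> : rising (x + 1) n = rising x n * (x + n%:R) / x.
  by rewrite -rising_shift mulrC mulKf.
by rewrite -!mulrA (mulrC y^-1) -!mulrA.
Qed.

(** This ratio is 4^n / binomial(2n, n).  Going from m to m + 1 multiplies it by
    (m + 1) / (m + 1/2) <= sqrt ((m + 1) / m). *)
Lemma central_ratio_le (F : rcfType) n : (0 < n)%N ->
  rising 1 n / rising 2^-1 n <= 2 * Num.sqrt n%:R :> F.
Proof.
case: n => // n _; elim: n => [|n IH].
  by rewrite /rising !big_ord_recl !big_ord0 sqrtr1 /= !addr0 !mulr1 invrK; lra.
have s0 : 0 <= Num.sqrt n.+1%:R :> F by exact: sqrtr_ge0.
have t0 : 0 < Num.sqrt n.+2%:R :> F by rewrite sqrtr_gt0.
have s2 : Num.sqrt n.+1%:R ^+ 2 = n.+1%:R :> F by rewrite sqr_sqrtr.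
have t2 : Num.sqrt n.+2%:R ^+ 2 = n.+1%:R + 1 :> F by rewrite sqr_sqrtr// natr1.
rewrite (risingS 1) (risingS 2^-1) invfM mulrACA.
have m0 : 1 <= n.+1%:R :> F by rewrite ler1n.
apply: le_trans (ler_wpM2r _ IH) _; first by rewrite divr_ge0//; lra.
rewrite mulrA ler_pdivrMr; last lra.
set m := n.+1%:R in m0 s2 t2 *; set s := Num.sqrt _ in s0 s2 *.
set t := Num.sqrt _ in t0 t2 *.
rewrite -!mulrA ler_pM2l//.
rewrite -(@ler_pXn2r _ 2)// ?nnegrE; [|apply: mulr_ge0; lra..].
rewrite !exprMn s2 t2.
nra.
Qed.

(** Raising [u] by 2 multiplies the left-hand side by 1 + 2n/u, and this is at
    most n when 3 <= u <= n; for u = 1 and u = 2 it exceeds n, which the room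
    left by the bounds 1 and 2 sqrt n absorbs. *)
Lemma rising_ratio_le (F : rcfType) u n : (0 < u <= n)%N ->
  rising (u%:R / 2) n / rising 2^-1 n <= 4 * Num.sqrt n%:R ^+ u.-1 :> F.
Proof.
move=> /andP[u0 un]; have n0 : (0 < n)%N := leq_trans u0 un.
have r0 : 0 < rising 2^-1 n :> F by rewrite rising_gt0 ?invr_gt0.
have n1 : 1 <= n%:R :> F by rewrite ler1n.
set s := Num.sqrt n%:R; have s2 : s ^+ 2 = n%:R by rewrite sqr_sqrtr.
have s0 : 0 <= s by exact: sqrtr_ge0.
have step k : k.+3%:R / 2 = k.+1%:R / 2 + 1 :> F by rewrite -2!natr1; field.
have H1 : rising (1%:R / 2) n / rising 2^-1 n <= 1 :> F.
  by rewrite mul1r divff// lt0r_neq0.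
have H2 : rising (2%:R / 2) n / rising 2^-1 n <= 2 * s.
  by rewrite divff//; exact: central_ratio_le.
have H3 : rising (3%:R / 2) n / rising 2^-1 n <= 4 * s ^+ 2.
  rewrite step rising_ratio_add1 ?divr_gt0//.
  apply: le_trans (ler_wpM2r _ H1) _; first by rewrite divr_ge0//; lra.
  by rewrite s2; lra.
have H4 : rising (4%:R / 2) n / rising 2^-1 n <= 4 * s ^+ 3.
  rewrite step rising_ratio_add1 ?divr_gt0//.
  apply: le_trans (ler_wpM2r _ H2) _; first by rewrite divr_ge0//; lra.
  rewrite [s ^+ 3]exprSr s2; nra.
suff H k : ((k.+3 <= n)%N ->
     rising (k.+3%:R / 2) n / rising 2^-1 n <= 4 * s ^+ k.+2) /\
   ((k.+4 <= n)%N ->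
     rising (k.+4%:R / 2) n / rising 2^-1 n <= 4 * s ^+ k.+3).
  case: u u0 un => [//|[|[|[|u]]]] _ un /=.
  - by apply: le_trans H1 _; rewrite expr0; lra.
  - by apply: le_trans H2 _; rewrite expr1; lra.
  - exact: H3.
  - by have [_] := H u; apply.
elim: k => [|k [IH3 IH4]]; first by split.
split; [exact: IH4|move=> kn].
have {}IH3 : rising (k.+3%:R / 2) n / rising 2^-1 n <= 4 * s ^+ k.+2.
  by apply: IH3; do 2 apply: ltnW.
have k3 : 3 <= k.+3%:R :> F by rewrite ler_nat.
have kn3 : k.+3%:R <= n%:R :> F by rewrite ler_nat; do 2 apply: ltnW.
rewrite step rising_ratio_add1 ?divr_gt0//.
apply: le_trans (ler_wpM2r _ IH3) _; first by rewrite divr_ge0//; lra.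
rewrite [s ^+ k.+4](_ : _ = s ^+ k.+2 * n%:R); last by rewrite -s2 -exprD addn2.
rewrite [leRHS]mulrA ler_wpM2l ?(mulr_ge0 _ (exprn_ge0 _ s0))// ler_pdivrMr ?divr_gt0//.
nra.
Qed.

End rising.

(** * Sums over countable sets and discrete probabilities *)

Section esum_facts.
Local Open Scope ereal_scope.

Lemma esumZl (R : realType) (T : choiceType) (D : set T) (f : T -> \bar R)
    (r : R) : (0 <= r)%R -> (forall x, 0 <= f x) ->
  \esum_(x in D) (r%:E * f x) = r%:E * \esum_(x in D) f x.
Proof.
have le (s : R) (g : T -> \bar R) : (0 <= s)%R -> (forall x, 0 <= g x) ->
    \esum_(x in D) (s%:E * g x) <= s%:E * \esum_(x in D) g x.
  move=> s0 g0; apply: ge_ereal_sup => _ [X XD <-].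
  rewrite -ge0_mule_fsumr//; apply: lee_wpmul2l; first by rewrite lee_fin.
  by apply: esum_ge; exists X.
rewrite le_eqVlt => /predU1P[<-|r0] f0.
  by rewrite mul0e esum1// => x _; rewrite mul0e.
apply/eqP; rewrite eq_le le ?(ltW r0)//=.
have rf0 x : 0 <= r%:E * f x by rewrite mule_ge0// lee_fin ltW.
(* The reverse bound is [le] for [r^-1] and the family [r%:E * f]. *)
rewrite -lee_pdivlMl//; apply: le_trans (le r^-1%R _ _ rf0); last first.
  by rewrite invr_ge0 ltW.
apply: le_esum => x _; rewrite muleA -EFinM mulVf ?mul1e//.
by rewrite gt_eqF.
Qed.

Lemma esum_seq (R : realType) (T : choiceType) (r : seq T) (f : T -> R) :
  uniq r -> (forall x, (0 <= f x)%R) ->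
  \esum_(x in [set` r]) (f x)%:E = (\sum_(x <- r) f x)%:E.
Proof.
move=> ur f0; rewrite esum_fset//; last by move=> x _; rewrite lee_fin.
by rewrite -fsbig_seq// sumEFin.
Qed.

Lemma esum_tupleS (R : realType) (T : choiceType) (n : nat)
    (f : seq T -> \bar R) : (forall s, 0 <= f s) ->
  \esum_(t in [set: n.+1.-tuple T]) f t =
  \esum_(t in [set: n.-tuple T]) \esum_(a in [set: T]) f (a :: t).
Proof.
move=> f0; rewrite esum_esum//=.
rewrite (reindex_esum ([set: n.-tuple T] `*`` (fun=> [set: T])) _
  (fun k : n.-tuple T * T => [tuple of k.2 :: k.1]))//.
split=> //.
- move=> [s a] [t b] _ _ /= /(congr1 val)[-> st].
  by congr (_, _); exact: val_inj.
- move=> t _; exists ([tuple of behead t], thead t) => //=.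
  by rewrite -tuple_eta.
Qed.

(** The probability is a series of weighted Dirac masses, indexed by the codes
    of an injection [T -> nat]; numbers that are not codes get weight 0. *)
Lemma exists_discrete_probability d (T : measurableType d) (R : realType)
    (w : T -> R) : countable [set: T] -> (forall x, (0 <= w x)%R) ->
  \esum_(x in [set: T]) (w x)%:E = 1 ->
  exists Q : probability T R, forall x, Q [set x] = (w x)%:E.
Proof.
move=> /countable_injP[f finj] w0 w1.
pose P k := `[< exists x, f x = k >].
pose e k : T := xget point [set x | f x = k].
have fe k : P k -> f (e k) = k.
  by move=> /asboolP[x fx]; rewrite /e; case: xgetP => // /(_ x).
have ef x : e (f x) = x.
  by apply: finj; rewrite ?inE// fe//; apply/asboolP; exists x.
have c0 k : (0 <= if P k then w (e k) else 0)%R by case: ifP.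
pose m k : {measure set T -> \bar R} := mscale (NngNum (c0 k)) \d_(e k).
pose mu : {measure set T -> \bar R} := mseries m 0.
have muE A : mu A = \esum_(x in [set: T]) (w x * (x \in A)%:R)%:E.
  have -> : [set: T] = [set e k | k in (fun k => P k)].
    apply/seteqP; split => // x _; exists (f x); last exact: ef.
    by apply/asboolP; exists x.
  rewrite esum_pred_image; last 2 first.
  - by move=> k _; rewrite lee_fin mulr_ge0.
  - by move=> j k /set_mem Pj /set_mem Pk ejk; rewrite -(fe j Pj) -(fe k Pk) ejk.
  rewrite /mu/= /mseries [RHS]eseries_mkcond; apply: eq_eseriesr => k _.
  by rewrite /m /= /mscale/= diracE -EFinM; case: ifP => //; rewrite mul0r.
have muT : mu [set: T] = 1.
  rewrite muE -[RHS]w1; apply: eq_esum => x _.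
  by rewrite in_setT mulr1.
(* Normalizing a measure of mass 1 does not change it, but makes it a
   probability. *)
exists (mnormalize mu \d_point) => x.
rewrite /= /mnormalize muT /= onee_eq0 /= invr1 mule1 muE.
rewrite (esumID [set x])/=; last by move=> y _; rewrite lee_fin mulr_ge0.
rewrite setTI setTI esum_set1 ?lee_fin ?mulr_ge0// mem_set// mulr1.
rewrite esum1 ?adde0// => y /= yx.
by rewrite memNset ?mulr0.
Qed.

End esum_facts.

(** * The sequential mixture *)

Section mixture.
Context {R : realType} {T : choiceType}.
Context (S : seq T) (phat : T -> R).
Context (uniqS : uniq S) (phat0 : forall a, (0 <= phat a)%R).
Local Open Scope ring_scope.

(** The closed form of a product of conditional weights, given by
    [mixture_weight_in] for letters of [S] (the Krichevsky-Trofimov rule) and by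
    [mixture_weight_notin] for the others.  Words are read from right to left,
    so that a new letter is put at the head. *)
Definition mixture_weight (s : seq T) : R :=
  (\prod_(a <- s | a \notin S) phat a)
  * (\prod_(b <- S) rising 2^-1 (count_mem b s))
  / rising ((size S)%:R / 2) (count (mem S) s).

Lemma mixture_weight_nil : mixture_weight [::] = 1.
Proof.
rewrite /mixture_weight big_nil mul1r [rising _ _]big_ord0 divr1.
by rewrite big1// => b _; rewrite /rising big_ord0.
Qed.

Lemma mixture_weight_notin a s : a \notin S ->
  mixture_weight (a :: s) = mixture_weight s * phat a.
Proof.
move=> aS; rewrite /mixture_weight big_cons aS /= (negbTE aS) add0n.
rewrite (eq_big_seq (fun b => rising 2^-1 (count_mem b s))); last first.
  by move=> b bS /=; case: eqP bS aS => [-> ->|].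
by rewrite -!mulrA mulrC -!mulrA.
Qed.

Lemma mixture_weight_in a s : a \in S ->
  mixture_weight (a :: s) = mixture_weight s
    * ((2^-1 + (count_mem a s)%:R)
       / ((size S)%:R / 2 + (count (mem S) s)%:R)).
Proof.
move=> aS; rewrite /mixture_weight big_cons aS /= !(bigD1_seq a aS uniqS)/=.
rewrite aS eqxx add1n !risingS.
have -> : \prod_(b <- S | b != a) rising 2^-1 ((a == b) + count_mem b s)
    = \prod_(b <- S | b != a) rising 2^-1 (count_mem b s) :> R.
  by apply: eq_bigr => b; rewrite eq_sym => /negbTE ->.
by rewrite invfM; lra.
Qed.

Lemma mixture_weight_ge0 s : 0 <= mixture_weight s.
Proof.
elim: s => [|a s IH]; first by rewrite mixture_weight_nil.
case: (boolP (a \in S)) => aS; last first.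
  by rewrite mixture_weight_notin//; exact: mulr_ge0.
rewrite mixture_weight_in// mulr_ge0// divr_ge0 ?addr_ge0 ?invr_ge0//.
Qed.

Lemma sum_count_mem s : (\sum_(b <- S) count_mem b s)%N = count (mem S) s.
Proof.
elim: s => [|a s IH] /=; first by rewrite big1.
rewrite big_split/= IH; congr addn; case: (boolP (a \in S)) => aS /=.
  rewrite (bigD1_seq a aS uniqS)/= eqxx big1 ?addn0// => b.
  by rewrite eq_sym => /negbTE ->.
by rewrite big1_seq// => b /andP[_ bS]; case: eqP bS aS => [-> ->|].
Qed.

Lemma prod_count_mem (p : T -> R) s :
  \prod_(b <- S) p b ^+ count_mem b s = \prod_(a <- s | a \in S) p a.
Proof.
elim: s => [|a s IH] /=; first by rewrite big_nil big1// => b _; rewrite expr0.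
rewrite big_cons -IH; under eq_bigr do rewrite exprD.
rewrite big_split/=; case: ifPn => aS.
  rewrite (bigD1_seq a aS uniqS)/= eqxx expr1 [X in _ * X * _]big1 ?mulr1// => b.
  by rewrite eq_sym => /negbTE ->.
rewrite big1_seq ?mul1r// => b /andP[_ bS].
by case: eqP bS aS => [-> ->|].
Qed.

(** The Krichevsky-Trofimov weights sum to 1 over [S], and the envelope sums to
    [F] outside [S]. *)
Lemma esum_mixture_weight_cons (F : R) (s : seq T) : (0 < size S)%N ->
  (\esum_(a in ~` [set` S]) (phat a)%:E = F%:E)%E ->
  (\esum_(a in [set: T]) (mixture_weight (a :: s))%:E
    = (mixture_weight s * (1 + F))%:E)%E.
Proof.
move=> S0 FE; have W0 := mixture_weight_ge0.
have u0 : 0 < (size S)%:R / 2 :> R by rewrite divr_gt0 ?ltr0n.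
rewrite (esumID [set` S])/=; last by move=> a _; rewrite lee_fin.
rewrite !setTI esum_seq// (eq_big_seq _ (fun a => @mixture_weight_in a s)).
rewrite -big_distrr /= -mulr_suml.
have -> : \sum_(b <- S) (2^-1 + (count_mem b s)%:R)
    = (size S)%:R / 2 + (count (mem S) s)%:R :> R.
  rewrite big_split/= big_const_seq count_predT iter_addr_0.
  by rewrite -natr_sum sum_count_mem mulr_natl.
have k0 : 0 <= (count (mem S) s)%:R :> R by [].
rewrite divff ?mulr1; last by rewrite lt0r_neq0// ltr_wpDr.
rewrite (eq_esum (b := fun a => (mixture_weight s)%:E * (phat a)%:E)%E);
  last by move=> a /= /negP aS; rewrite mixture_weight_notin.
rewrite esumZl//.
by rewrite FE -EFinM -EFinD mulrDr mulr1.
Qed.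

Lemma esum_mixture_weight (F : R) n : (0 < size S)%N ->
  (\esum_(a in ~` [set` S]) (phat a)%:E = F%:E)%E ->
  (\esum_(t in [set: n.-tuple T]) (mixture_weight t)%:E
    = ((1 + F) ^+ n)%:E)%E.
Proof.
move=> S0 FE; have W0 := mixture_weight_ge0.
have F0 : 0 <= F by rewrite -lee_fin -FE esum_ge0// => a _; rewrite lee_fin.
elim: n => [|n IH].
  rewrite (_ : [set: 0.-tuple T] = [set [tuple]]).
    by rewrite esum_set1 ?lee_fin// mixture_weight_nil.
  by apply/seteqP; split=> // t _ /=; rewrite tuple0.
rewrite (@esum_tupleS _ _ n (fun s => (mixture_weight s)%:E))//.
under eq_esum do rewrite (esum_mixture_weight_cons _ S0 FE) mulrC EFinM.
rewrite esumZl ?IH ?exprS ?addr_ge0//.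
by move=> t; rewrite lee_fin.
Qed.

(** The letters outside [S] are bounded through [phat], those in [S] through
    [rising_half_prod].  The latter gives the ratio of rising factorials at the
    number of letters in [S], which grows with that number because [S] is
    nonempty. *)
Lemma le_mixture_weight (p : T -> R) (s : seq T) n :
  (size s <= n)%N -> (0 < size S)%N ->
  (forall a, 0 <= p a <= phat a) -> \sum_(b <- S) p b <= 1 ->
  \prod_(a <- s) p a
    <= rising ((size S)%:R / 2) n / rising 2^-1 n * mixture_weight s.
Proof.
move=> sn S0 pphat psum.
have p0 a : 0 <= p a by have /andP[] := pphat a.
have r0 k : 0 < rising 2^-1 k :> R by rewrite rising_gt0 ?invr_gt0.
have u0 : 0 < (size S)%:R / 2 :> R by rewrite divr_gt0 ?ltr0n.
have v0 k : 0 < rising ((size S)%:R / 2) k :> R by rewrite rising_gt0.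
set c := count (mem S) s.
have cn : (c <= n)%N := leq_trans (count_size _ _) sn.
have uh : 2^-1 <= (size S)%:R / 2 :> R.
  by rewrite -[leLHS]mul1r ler_pM2r ?invr_gt0// ler1n.
have h0 : 0 < 2^-1 :> R by rewrite invr_gt0.
apply: le_trans (ler_wpM2r (mixture_weight_ge0 s) (rising_ratio_homo h0 uh cn)).
rewrite /mixture_weight -/c (bigID (mem S)) /= mulrC.
have A : \prod_(a <- s | a \notin S) p a <= \prod_(a <- s | a \notin S) phat a.
  by apply: ler_prod => a _; exact: pphat.
have B : \prod_(a <- s | a \in S) p a * rising 2^-1 c
    <= \prod_(b <- S) rising 2^-1 (count_mem b s).
  rewrite -prod_count_mem /c -sum_count_mem.
  apply: le_trans (rising_half_prod S (fun b => count_mem b s) p0) _.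
  rewrite ler_piMr//; first by apply: prodr_ge0 => b _; exact: ltW.
  by rewrite exprn_ile1// sumr_ge0.
rewrite [leRHS](_ : _ = (\prod_(a <- s | a \notin S) phat a) *
   (\prod_(b <- S) rising 2^-1 (count_mem b s) / rising 2^-1 c)); last first.
  by field; rewrite !lt0r_neq0.
apply: ler_pM => //; [exact: prodr_ge0|exact: prodr_ge0|].
by rewrite ler_pdivlMr.
Qed.

End mixture.

(** * Laws of memoryless sources *)

Section sources.
Context {d : measure_display} {X : measurableType d} {R : realType}.
Context (mX1 : forall a : X, measurable [set a]).
Local Open Scope ereal_scope.

Lemma law_memoryless (P : probability (sequence_space X) R) n
    (x : n.-tuple X) : stationary_memoryless P ->
  law n P [set x] = \prod_(a <- x) law 1 P [set [tuple a]].
Proof.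
move=> [indep ident].
have law1E a i : law 1 P [set [tuple a]] = P [set w | [set a] (w i)].
  rewrite (ident i 0%N [set a])//; congr (P _); apply/seteqP; split => w /=.
    by move=> /(congr1 (@thead _ _)); rewrite theadE /thead tnth_mktuple.
  by move=> wa; apply/eq_from_tnth => j; rewrite tnth_mktuple ord1 wa.
have -> : law n P [set x] =
    P [set w | forall i, i \in iota 0 n -> [set nth point x i] (w i)].
  congr (P _); apply/seteqP; split => w /=.
    move=> <- i; rewrite mem_iota /= add0n => ni.
    by rewrite (nth_map (Ordinal ni)) ?size_enum_ord// nth_enum_ord.
  move=> wx; apply/eq_from_tnth => j.
  by rewrite tnth_mktuple wx ?mem_iota ?add0n ?ltn_ord// -tnth_nth.
rewrite (indep _ (fun i => [set nth point x i])) ?iota_uniq// [RHS](big_nth point) size_tuple.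
by rewrite /index_iota subn0; apply: eq_bigr => i _; rewrite (law1E _ i).
Qed.

Lemma sum_singletons_le1 (Q : probability (1.-tuple X) R) (S : seq X) :
  uniq S -> \sum_(b <- S) Q [set [tuple b]] <= 1.
Proof.
move=> uS; rewrite (fsbig_seq _ _ uS).
have m1 (b : X) : measurable [set [tuple b]].
  rewrite (_ : [set _] = [set: 1.-tuple X] `&` (fun t => tnth t ord0) @^-1` [set b]).
    exact: measurable_tnth.
  rewrite setTI; apply/seteqP; split=> t /=; first by move=> ->.
  by move=> tb; apply/eq_from_tnth => j; rewrite ord1 tb.
rewrite -measure_fin_bigcup//.
  apply: probability_le1; apply: fin_bigcup_measurable => //.
by move=> a b _ _ [t [/= -> /(congr1 (@thead _ _))]].
Qed.

End sources.

(** * Regret of a coding distribution *)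

Section regret.
Context {d : measure_display} {T : measurableType d} {R : realType}.
Local Open Scope ereal_scope.

Lemma elog2_le (P Q C : R) : (0 <= P)%R -> (0 < C)%R -> (0 <= Q)%R ->
  (P <= C * Q)%R -> elog2 (P%:E / Q%:E) <= (ln C / ln 2)%:E.
Proof.
move=> P0 C0 Q0 PQ; rewrite /elog2 EFinM.
have l2 : (0 < (ln 2)^-1 :> R)%R by rewrite invr_gt0 ln_gt0// ltr1n.
apply: lee_wpmul2r; first by rewrite lee_fin ltW.
move: P0; rewrite le_eqVlt => /predU1P[<-|P0].
  by rewrite mul0e le0_lneNy// leNye.
have {}Q0 : (0 < Q)%R.
  rewrite lt_neqAle Q0 andbT; apply/eqP => Q0'.
  by move: PQ; rewrite -Q0' mulr0 leNgt P0.
rewrite inver gt_eqF// -EFinM lne_EFin ?divr_gt0// lee_fin.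
by rewrite ler_ln ?posrE ?divr_gt0// ler_pdivrMr.
Qed.

(** Any coding distribution bounds the infimum from above, and the hypothesis
    bounds all its likelihood ratios by [C]. *)
Lemma minimax_regret_le (M : set (probability T R)) (Q : probability T R)
    (q : T -> R) (C : R) : (0 < C)%R -> (forall x, Q [set x] = (q x)%:E) ->
  (forall P x, M P -> P [set x] <= (C * q x)%:E) ->
  minimax_regret M <= (ln C / ln 2)%:E.
Proof.
move=> C0 Qq PQ; apply: ge_ereal_inf; eexists; first by exists Q.
apply: ge_ereal_sup => _ [x _ <-]; apply: ge_ereal_sup => _ [P MP <-].
have P0 : 0 <= P [set x] by [].
have Pfin : P [set x] \is a fin_num.
  by rewrite ge0_fin_numE//; apply: le_lt_trans (PQ P x MP) (ltry _).
rewrite Qq -(fineK Pfin) elog2_le ?fine_ge0// -lee_fin ?fineK ?PQ//.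
by rewrite -Qq.
Qed.

Lemma minimax_regret_set0 :
  minimax_regret (set0 : set (probability T R)) = -oo.
Proof.
apply/eqP; rewrite -leeNy_eq; apply: ge_ereal_inf.
eexists; first by exists \d_point.
by apply: ge_ereal_sup => _ [x _ <-]; rewrite image_set0 ereal_sup0.
Qed.

End regret.

(** * Envelope classes on the positive integers *)

Definition letters_upto (u : nat) : seq Npos :=
  pmap (insub : nat -> option {k : nat | (0 < k)%N}) (iota 1 u).

Lemma letters_upto_uniq u : uniq (letters_upto u).
Proof. by rewrite pmap_sub_uniq ?iota_uniq. Qed.

Lemma size_letters_upto u : size (letters_upto u) = u.
Proof.
rewrite size_pmap_sub -[RHS](size_iota 1); apply/eqP; rewrite -all_count.
by apply/allP => k; rewrite mem_iota => /andP[].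
Qed.

Lemma notin_letters_upto u :
  ~` [set` letters_upto u] = [set k : Npos | (u < sval k)%N].
Proof.
apply/seteqP; split => k /=.
- move=> /negP; rewrite mem_pmap_sub mem_iota /= negb_and -leqNgt -ltnNge.
  by rewrite leqNgt (svalP k) /= add1n.
- move=> uk; rewrite mem_pmap_sub mem_iota => /andP[_ ku].
  by have := leq_trans ku uk; rewrite ltnn.
Qed.

(** Base-2 logarithms: 4 contributes the constant 2, and [1 + F] contributes
    at most [F * log e]. *)
Lemma log_regret_bound (R : realType) (F : R) (n u : nat) : (0 <= F)%R -> (0 < u <= n)%N ->
  (ln (4 * Num.sqrt n%:R ^+ u.-1 * (1 + F) ^+ n) / ln 2
   <= n%:R * F * (ln (expR 1) / ln 2)
      + (u%:R - 1) / 2 * (ln n%:R / ln 2) + 2)%R.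
Proof.
move=> F0 /andP[u0 un]; have n0 : (0 < n)%N := leq_trans u0 un.
have l2 : (0 < ln 2 :> R)%R by rewrite ln_gt0// ltr1n.
have s0 : (0 < Num.sqrt n%:R :> R)%R by rewrite sqrtr_gt0 ltr0n.
have F1 : (0 < 1 + F)%R by rewrite ltr_wpDr.
have lnF : (ln (1 + F) <= F)%R by rewrite -[leRHS]expRK ler_ln ?posrE ?expR_gt0// expR_ge1Dx.
have lns : (ln n%:R = ln (Num.sqrt n%:R) *+ 2 :> R)%R.
  by rewrite -lnXn// sqr_sqrtr.
have ln4 : (ln 4 = ln 2 *+ 2 :> R)%R by rewrite -lnXn//; congr ln; rewrite -natrX.
rewrite !lnM ?posrE ?mulr_gt0 ?exprn_gt0//.
rewrite !lnXn// ln4 lns expRK ler_pdivrMr//.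
have -> : ((n%:R * F * (1 / ln 2)
   + (u%:R - 1) / 2 * (ln (Num.sqrt n%:R) *+ 2 / ln 2) + 2) * ln 2
   = n%:R * F + (u%:R - 1) * ln (Num.sqrt n%:R) + 2 * ln 2)%R.
  by rewrite -mulr_natr; field; rewrite gt_eqF.
rewrite (_ : u%:R - 1 = u.-1%:R)%R; last by rewrite -subn1 natrB.
rewrite -(mulr_natl (ln 2)) -(mulr_natl (ln (Num.sqrt _))) -(mulr_natl (ln (1 + F))).
have := ler_wpM2l (ler0n R n) lnF; lra.
Qed.

Section envelope_class.
Context {R : realType}.
Context (L : set (probability (sequence_space Npos) R)).
Local Open Scope ereal_scope.

Lemma measurable_Npos1 (a : Npos) : measurable [set a].
Proof. by []. Qed.

Lemma law1_le_envelope P a : L P ->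
  law 1 P [set [tuple a]] <= envelope (laws 1 L) a.
Proof. by move=> LP; apply: ereal_sup_ubound; exists (law 1 P) => //; exists P. Qed.

Lemma envelope_ge0 a : L !=set0 -> 0 <= envelope (laws 1 L) a.
Proof. by move=> [P LP]; apply: le_trans (law1_le_envelope a LP). Qed.

Lemma law1_singleton_le1 (P : probability (sequence_space Npos) R) a :
  law 1 P [set [tuple a]] <= 1.
Proof.
have := @sum_singletons_le1 _ _ _ measurable_Npos1 (law 1 P) [:: a] isT.
by rewrite big_seq1.
Qed.

Lemma envelope_fin_num a : L !=set0 -> envelope (laws 1 L) a \is a fin_num.
Proof.
move=> L0; rewrite ge0_fin_numE ?envelope_ge0//; apply: (@le_lt_trans _ _ 1).
  apply: ge_ereal_sup => _ [_ [P _ <-] <-]; exact: law1_singleton_le1.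
exact: ltry.
Qed.

(** The coding distribution is [mixture_weight], divided by its total mass
    [(1 + F) ^+ n], for the letters up to [u] and the envelope beyond. *)
Lemma minimax_regret_tail (F : R) (n u : nat) : L !=set0 ->
  (forall P, L P -> stationary_memoryless P) -> (0 < u <= n)%N ->
  tail (laws 1 L) u = F%:E ->
  minimax_regret (laws n L) <=
    (ln (4 * Num.sqrt n%:R ^+ u.-1 * (1 + F) ^+ n) / ln 2)%:E.
Proof.
move=> L0 memless un tailF.
pose phat a := fine (envelope (laws 1 L) a).
have phatE a : (phat a)%:E = envelope (laws 1 L) a.
  by rewrite fineK// envelope_fin_num.
have phat0 a : (0 <= phat a)%R by rewrite fine_ge0// envelope_ge0.
set S := letters_upto u.
have uS : uniq S by exact: letters_upto_uniq.
have S0 : (0 < size S)%N by rewrite size_letters_upto; case/andP: un.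
have FE : \esum_(a in ~` [set` S]) (phat a)%:E = F%:E.
  by rewrite -tailF notin_letters_upto; apply: eq_esum => a _; exact: phatE.
have F0 : (0 <= F)%R by rewrite -lee_fin -FE esum_ge0// => a _; rewrite lee_fin.
have F1 : (0 < (1 + F) ^+ n)%R by rewrite exprn_gt0// ltr_wpDr.
pose q (x : n.-tuple Npos) := (((1 + F) ^+ n)^-1 * mixture_weight S phat x)%R.
have q0 x : (0 <= q x)%R.
  by rewrite mulr_ge0 ?mixture_weight_ge0// invr_ge0 ltW.
have [||Q Qq] := @exists_discrete_probability _ (n.-tuple Npos) _ q _ q0.
- exact: countableP.
- under eq_esum do rewrite EFinM.
  rewrite esumZl ?invr_ge0 ?ltW//; last first.
    by move=> x; rewrite lee_fin mixture_weight_ge0.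
  by rewrite (esum_mixture_weight uS phat0 n S0 FE) -EFinM mulVf ?gt_eqF.
apply: (minimax_regret_le _ Qq).
  rewrite mulr_gt0// mulr_gt0// exprn_gt0// sqrtr_gt0 ltr0n.
  by case/andP: un => u0 /(leq_trans u0).
move=> _ x [P LP <-].
rewrite (law_memoryless measurable_Npos1)//; last exact: memless.
pose p a := fine (law 1 P [set [tuple a]]).
have pE a : law 1 P [set [tuple a]] = (p a)%:E.
  rewrite fineK// ge0_fin_numE//.
  exact: le_lt_trans (law1_singleton_le1 P a) (ltry _).
under eq_bigr do rewrite pE.
rewrite prodEFin lee_fin /q mulrA mulfK ?gt_eqF//.
have := @le_mixture_weight R _ S phat uS phat0 p x n.
rewrite size_tuple leqnn => /(_ isT S0) H.
apply: le_trans (H _ _) _.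
- move=> a; rewrite fine_ge0//= -lee_fin phatE -pE.
  exact: law1_le_envelope.
- rewrite -lee_fin -sumEFin; under eq_bigr do rewrite -pE.
  exact: sum_singletons_le1 measurable_Npos1 _ _ uS.
rewrite ler_wpM2r ?mixture_weight_ge0// size_letters_upto.
exact: rising_ratio_le.
Qed.

End envelope_class.

Unset Implicit Arguments.

Theorem theorem4 (R : realType) (L : set (probability (sequence_space Npos) R))
    (memoryless : forall P, L P -> stationary_memoryless P)
    (fin_entropy : forall P, L P -> finite_entropy P)
    (n : nat) (n_gt0 : (0 < n)%N) :
  minimax_regret (laws n L) <=
  ereal_inf [set n%:R%:E * tail (laws 1 L) u * elog2 (expR 1)%:E
                 + ((u%:R - 1) / 2)%:E * elog2 n%:R%:E
            | u in [set u : nat | (0 < u <= n)%N]] + 2%:E.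
Proof.
(* With no source at all, the regret of any coding distribution is -oo. *)
have [->|L0] := eqVneq L set0.
  by rewrite /laws image_set0 minimax_regret_set0 leNye.
move/set0P in L0; rewrite -leeBlDr//; apply/ereal_infP => _ [u un <-].
rewrite leeBlDr//.
have l2 : (0 < (ln 2)^-1 :> R)%R by rewrite invr_gt0 ln_gt0// ltr1n.
have e2 : elog2 (expR 1)%:E = (ln (expR 1) / ln 2)%:E :> \bar R.
  by rewrite /elog2 lne_EFin ?expR_gt0.
have n2 : elog2 n%:R%:E = (ln n%:R / ln 2)%:E :> \bar R.
  by rewrite /elog2 lne_EFin ?ltr0n.
rewrite e2 n2.
have tail0 : 0 <= tail (laws 1 L) u.
  by apply: esum_ge0 => a _; exact: envelope_ge0.
case tailE : (tail (laws 1 L) u) tail0 => [F| |] // F0; last first.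
  rewrite gt0_muley ?lte_fin ?ltr0n// gt0_mulye ?addye ?leey//.
  by rewrite lte_fin expRK mul1r.
apply: le_trans (minimax_regret_tail L0 memoryless un tailE) _.
by rewrite -!EFinM -!EFinD lee_fin log_regret_bound.
Qed.
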